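(* Let $g\ge2$. The spine $S_g$ is a deformation retract of $MG_g^0$.
   Context: Graphs are finite, connected, without legs, possibly with multiple edges and tadpoles. A weighted graph is a graph $G$ with vertex set $V_G$, edge set $E_G$, loop number $h_G=\dim H_1(G;\mathbb Q)$ and a map $w:V_G\to\{0,1,2,\dots\}$; its genus is $h_G+\sum_v w(v)$, its total weight is $\sum_v w(v)$. It is stable if $2w(v)+\mathrm{val}(v)>2$ for all $v$. For $\gamma\subset G$ given by a set of edges, $G/\gamma$ collapses each connected component of $\gamma$ to a vertex, whose weight is the loop number of that component plus the sum of the weights of its vertices. Isomorphisms of weighted graphs preserve weights. For each stable weighted graph $G$ of genus $g$ with at least one edge let $\Delta_G=\{x\in\mathbb R_{\ge0}^{E_G}:\sum_e x_e=1\}$, equivalently the set of classes $[x]$ of nonzero $x\in\mathbb R_{\ge0}^{E_G}$ up to rescaling. The space $MG_g$ is the quotient of the disjoint union of all $\Delta_G$ under the identifications of the face $\{x_e=0\ \forall e\in E_\gamma\}\subset\Delta_G$ with $\Delta_{G/\gamma}$ (for proper edge subsets $\gamma$), and of $x$ with $x\circ\varphi$ for isomorphisms $\varphi$ of weighted graphs. $MG_g^0\subset MG_g$ is the subspace of points represented by metric graphs (all edge lengths positive) with total weight $0$. For a stable graph $G$ of genus $g$ and total weight $0$ and a forest $F\subset G$ (a set $E_F\subset E_G$ of edges containing no cycle, possibly empty), let $$c(G,F)=\{[x]\in\Delta_G:\ x_i=x_j\ \text{for all } i,j\notin E_F,\ \ x_k\le x_i\ \text{for all } k\in E_F,\ i\notin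 E_F\}\cong[0,1]^{|E_F|}.$$ The spine $S_g\subset MG_g^0$ is the union of the images in $MG_g$ of all the cubes $c(G,F)$. *)

(* Defs.v *)
From HB Require Import structures.
From Stdlib Require Import Relation_Operators.
From mathcomp Require Import all_boot all_order all_algebra.
From mathcomp Require Import all_classical all_reals all_analysis.

Set Implicit Arguments.
Unset Strict Implicit.
Unset Printing Implicit Defensive.
Import Order.TTheory GRing.Theory Num.Theory.
Import numFieldNormedType.Exports.
Local Open Scope ring_scope.

(* Multiple edges and tadpoles are allowed.  Each edge carries an auxiliary
   orientation, which only serves to write down the boundary map: [joins] and
   the isomorphisms below ignore it. *)
Record wgraph (V E : finType) := WGraph {
  source : E -> V;
  target : E -> V;
  weight : V -> nat
}.

Section WGraph.
Variables (V E : finType) (G : wgraph V E).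
Implicit Types (gamma F : {set E}) (u v : V) (e : E).

Definition joins e u v : bool :=
  ((source G e == u) && (target G e == v))
  || ((source G e == v) && (target G e == u)).

Definition adj gamma : rel V := fun u v => [exists e in gamma, joins e u v].

Definition connected_graph : bool :=
  (0 < #|V|)%N && [forall u, forall v, connect (adj [set: E]%SET) u v].

(* A tadpole contributes 2 to the valency of its vertex. *)
Definition valency v : nat :=
  (#|[set e | source G e == v]%SET| + #|[set e | target G e == v]%SET|)%N.

Definition stable : bool :=
  [forall v, (2 < 2 * weight G v + valency v)%N].

(* Matrix of the cellular boundary map Q^gamma -> Q^V, acting on row vectors. *)
Definition boundary_mx gamma : 'M[rat]_(#|gamma|, #|V|) :=
  \matrix_(i, j) ((target G (enum_val i) == enum_val j)%:R
                  - (source G (enum_val i) == enum_val j)%:R).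

(* dim H_1(gamma; Q); there are no 2-cells, so H_1 is the kernel of the
   boundary map. *)
Definition loop_number gamma : nat := \rank (kermx (boundary_mx gamma)).

Definition total_weight : nat := (\sum_v weight G v)%N.

Definition genus : nat := (loop_number [set: E]%SET + total_weight)%N.

(* [:: (v_1, e_1); ...; (v_k, e_k)] with k >= 1, where e_i joins v_i to v_(i+1)
   and e_k joins v_k to v_1; the v_i are distinct and so are the e_i.
   Tadpoles (k = 1) and pairs of parallel edges (k = 2) are cycles. *)
Definition is_cycle (c : seq (V * E)) : bool :=
  [&& (0 < size c)%N, uniq (unzip1 c), uniq (unzip2 c)
    & cycle (fun p q => joins p.2 p.1 q.1) c].

Definition forest F : Prop :=
  forall c, is_cycle c -> ~ {subset unzip2 c <= F}.

(* Vertex set of the connected component of v in (V, gamma). *)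
Definition component gamma v : {set V} := [set u | connect (adj gamma) v u]%SET.

Definition components gamma : {set {set V}} :=
  [set component gamma v | v : V]%SET.

Fact component_in gamma v : component gamma v \in components gamma.
Proof. exact: imset_f. Qed.

Definition contract_vertex gamma : finType := {B : {set V} | B \in components gamma}.
Definition contract_edge gamma : finType := {e : E | e \notin gamma}.

Definition to_component gamma v : contract_vertex gamma :=
  exist _ (component gamma v) (component_in gamma v).

Definition edges_in gamma (B : {set V}) : {set E} :=
  [set e in gamma | (source G e \in B) && (target G e \in B)]%SET.

Definition contraction gamma :
    wgraph (contract_vertex gamma) (contract_edge gamma) :=
  {| source := fun e : contract_edge gamma => to_component gamma (source G (val e));
     target := fun e : contract_edge gamma => to_component gamma (target G (val e));
     weight := fun B : contract_vertex gamma =>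
       (loop_number (edges_in gamma (val B)) + \sum_(v in val B) weight G v)%N |}.

End WGraph.

Record wgraph_iso (V E V' E' : finType) (G : wgraph V E) (G' : wgraph V' E') :=
  WGraphIso {
    iso_vertex : V -> V';
    iso_edge : E -> E';
    iso_vertex_bij : bijective iso_vertex;
    iso_edge_bij : bijective iso_edge;
    iso_joins : forall e,
      joins G' (iso_edge e) (iso_vertex (source G e)) (iso_vertex (target G e));
    iso_weight : forall v, weight G' (iso_vertex v) = weight G v
  }.

Local Open Scope classical_set_scope.

(* Every finite graph is isomorphic to one with vertex and edge sets of the
   form 'I_n; restricting to these makes the disjoint union of the simplices a
   type, and does not change the quotient. *)
Record lgraph := LGraph {
  nvert : nat;
  nedge : nat;
  graph_of :> wgraph 'I_nvert 'I_nedge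
}.

HB.instance Definition _ := gen_eqMixin lgraph.
HB.instance Definition _ := gen_choiceMixin lgraph.

Definition stable_of_genus (g : nat) (G : lgraph) : bool :=
  [&& connected_graph G, stable G, genus G == g & (0 < nedge G)%N].

Definition stable_graph (g : nat) : choiceType :=
  {G : lgraph | stable_of_genus g G}.

Definition simplex (R : realType) (G : lgraph) : set 'rV[R]_(nedge G) :=
  [set x | (forall e, 0 <= x ord0 e) /\ \sum_e x ord0 e = 1].

Definition simplex_space (R : realType) (G : lgraph) : topologicalType :=
  set_type (@simplex R G).

Definition simplices (R : realType) (g : nat) : topologicalType :=
  {G : stable_graph g & simplex_space R (val G)}.

Section Moduli.
Variables (R : realType) (g : nat).
Implicit Types p q : simplices R g.

Definition gr p : lgraph := val (projT1 p).
Definition len p (e : 'I_(nedge (gr p))) : R :=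
  set_val (projT2 p : set_type (@simplex R (gr p))) ord0 e.

(* The edges of gr p / gamma are the complement of gamma, so its simplex is the
   face {x = 0 on gamma}; phi transports it to the labelled copy gr q. *)
Definition face_step p q : Prop :=
  exists gamma : {set 'I_(nedge (gr p))},
    [/\ (gamma \proper [set: 'I_(nedge (gr p))]%SET),
        (forall e, e \in gamma -> len e = 0)
      & exists phi : wgraph_iso (contraction (gr p) gamma) (gr q),
          forall e : contract_edge gamma, len (iso_edge phi e) = len (val e)].

Definition iso_step p q : Prop :=
  exists phi : wgraph_iso (gr p) (gr q),
    forall e, len (iso_edge phi e) = len e.

Definition MG_step p q : Prop := face_step p q \/ iso_step p q.

Definition MG_equiv : rel (simplices R g) :=
  fun p q => `[< clos_refl_sym_trans _ MG_step p q >].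

Lemma MG_equiv_refl : reflexive MG_equiv.
Proof. by move=> p; apply/asboolP; exact: rst_refl. Qed.

Lemma MG_equiv_sym : symmetric MG_equiv.
Proof. by move=> p q; apply: asbool_equiv_eq; split=> ?; exact: rst_sym. Qed.

Lemma MG_equiv_trans : transitive MG_equiv.
Proof.
by move=> q p r /asboolP pq /asboolP qr; apply/asboolP; exact: rst_trans pq qr.
Qed.

Canonical MG_equivRel :=
  EquivRel MG_equiv MG_equiv_refl MG_equiv_sym MG_equiv_trans.

Definition MG : topologicalType :=
  quotient_topology {eq_quot MG_equivRel}%qT.

Definition MG_class p : MG := (\pi_({eq_quot MG_equivRel}) p)%qT.

Definition MG0 : set MG :=
  [set MG_class p | p in
    [set p | (forall e : 'I_(nedge (gr p)), 0 < len e)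
             /\ total_weight (gr p) = 0%N]].

(* x lies in c(G, F), for the point p = (G, x). *)
Definition in_cube p (F : {set 'I_(nedge (gr p))}) : Prop :=
  (forall i j, i \notin F -> j \notin F -> len i = len j)
  /\ (forall k i, k \in F -> i \notin F -> len k <= len i).

Definition spine : set MG :=
  [set MG_class p | p in
    [set p | total_weight (gr p) = 0%N
             /\ exists F : {set 'I_(nedge (gr p))},
                  forest (gr p) F /\ in_cube F]].

End Moduli.

Arguments MG0 R g : clear implicits.
Arguments spine R g : clear implicits.

(* A is a deformation retract of X, both seen as subspaces of T: the homotopy
   fixes the points of A at all times. *)
Definition deformation_retract (R : realType) (T : topologicalType)
    (X A : set T) : Prop :=
  A `<=` X /\
  exists H : T * R -> T,
    [/\ {within X `*` `[0, 1], continuous H},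
        (forall x (t : R), X x -> `[0, 1] t -> X (H (x, t))),
        (forall x, X x -> H (x, 0) = x),
        (forall x, X x -> A (H (x, 1)))
      & (forall a (t : R), A a -> `[0, 1] t -> H (a, t) = a)].

Arguments deformation_retract R {T} X A.

(* Main.v *)
(* Let lambda be the largest level c <= 1 such that the edges of G shorter than
   c form a forest.  A point (G, x) lies over MG_g^0 exactly when G has weight 0
   and the zero edges of x form a forest, i.e. lambda > 0; cutting x down to
   min(x, lambda) and normalising then gives a point of the cube c(G, F) with
   F = {x < lambda}, and x = min(x, lambda) on such a cube.  The straight line
   from x to min(x, lambda) is the homotopy.  It respects the gluing because
   lambda is unchanged by isomorphisms and by contracting forests of zero edges.
   It is continuous on the quotient by the tube lemma, [0, 1] being locally
   compact. *)
Require Import Defs.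
From Stdlib Require Import Relation_Operators.
From mathcomp Require Import all_boot all_order all_algebra zify.

Set Implicit Arguments.
Unset Strict Implicit.
Unset Printing Implicit Defensive.
Import Order.TTheory GRing.Theory Num.Theory.
Local Open Scope ring_scope.

(** * Forests and the boundary map *)

Section BoundarySpan.
Variables (V E : finType) (G : wgraph V E).
Implicit Types (F : {set E}) (u v : V) (e : E).

Lemma joinsC e u v : joins G e u v = joins G e v u.
Proof. by rewrite /joins orbC. Qed.

Lemma joins_ends e : joins G e (source G e) (target G e).
Proof. by rewrite /joins !eqxx. Qed.

Lemma adj_sym F : symmetric (adj G F).
Proof. by move=> u v; apply: eq_existsb => e; rewrite joinsC. Qed.

Lemma connect_adjC F u v : connect (adj G F) u v = connect (adj G F) v u.
Proof. exact/sym_connect_sym/adj_sym. Qed.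

Lemma adj_joins F e u v : e \in F -> joins G e u v -> adj G F u v.
Proof. by move=> eF j; apply/existsP; exists e; rewrite eF. Qed.

Lemma connect_ends F e : e \in F -> connect (adj G F) (source G e) (target G e).
Proof. by move=> eF; apply/connect1/(adj_joins eF)/joins_ends. Qed.

Lemma connect_adjS F F' u v :
  F \subset F' -> connect (adj G F) u v -> connect (adj G F') u v.
Proof.
move=> /subsetP FF'; apply: connect_sub => {}u {}v /existsP[e /andP[eF j]].
exact/connect1/(adj_joins (FF' _ eF)).
Qed.

Definition vtx v : 'rV[rat]_#|V| := delta_mx 0 (enum_rank v).
Definition bd e : 'rV[rat]_#|V| := vtx (target G e) - vtx (source G e).
(** The row space of [boundary_mx], summed over the edges themselves rather than over an
    enumeration, so that inclusions and images of edge sets act on it directly. *)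
Definition bspan F : 'M[rat]_#|V| := (\sum_(e in F) <<bd e>>)%MS.

Lemma bd_sub F e : e \in F -> (bd e <= bspan F)%MS.
Proof. by move=> eF; apply: (sumsmx_sup e) => //; rewrite genmxE. Qed.

Lemma bspan_subP F m (A : 'M_(m, #|V|)) :
  reflect (forall e, e \in F -> (bd e <= A)%MS) (bspan F <= A)%MS.
Proof.
apply: (iffP sumsmx_subP) => h e eF; last by rewrite genmxE; exact: h.
by have := h e eF; rewrite genmxE.
Qed.

Lemma bspanS F F' : F \subset F' -> (bspan F <= bspan F')%MS.
Proof. by move=> /subsetP s; apply/bspan_subP => e /s; exact: bd_sub. Qed.

Lemma row_boundary_mx F i : row i (boundary_mx G F) = bd (enum_val i).
Proof.
apply/rowP => j; rewrite !mxE /= -!(can2_eq enum_rankK enum_valK).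
by rewrite ![_ == j]eq_sym.
Qed.

Lemma boundary_mxE F : (boundary_mx G F :=: bspan F)%MS.
Proof.
apply/eqmxP/andP; split.
  by apply/row_subP => i; rewrite row_boundary_mx; apply/bd_sub/enum_valP.
apply/bspan_subP => e eF.
by rewrite -(enum_rankK_in eF eF) -row_boundary_mx row_sub.
Qed.

Lemma rank_bspan_le F : (\rank (bspan F) <= #|F|)%N.
Proof. by rewrite -boundary_mxE rank_leq_row. Qed.

Lemma loop_numberE F : loop_number G F = (#|F| - \rank (bspan F))%N.
Proof. by rewrite /loop_number mxrank_ker boundary_mxE. Qed.

(** A walk telescopes into boundary vectors. Conversely, the indicator of the component of u is a
    functional that vanishes on [bspan F] and separates u from all vertices outside this
    component. *)
Lemma connect_bspan F u v :
  connect (adj G F) u v = (vtx v - vtx u <= bspan F)%MS.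
Proof.
apply/idP/idP.
  case/connectP => p; elim: p u v => [|w p IH] u v /=.
    by move=> _ ->; rewrite subrr sub0mx.
  case/andP=> /existsP[e /andP[eF j]] pth ->.
  have -> : vtx (last w p) - vtx u = (vtx (last w p) - vtx w) + (vtx w - vtx u).
    by rewrite addrA subrK.
  apply: addmx_sub; first exact: IH.
  have := bd_sub eF; rewrite /bd.
  case/orP: j => /andP[/eqP-> /eqP->] //.
  by rewrite -[(_ - _ <= _)%MS]eqmx_opp opprB.
pose chi : 'cV[rat]_#|V| := \col_j (connect (adj G F) u (enum_val j))%:R.
have vchi w : vtx w *m chi = (connect (adj G F) u w)%:R%:M.
  rewrite -rowE; apply/matrixP => i j; rewrite !mxE enum_rankK !ord1 eqxx.
  by rewrite mulr1n.
have sub_ker : (bspan F <= kermx chi)%MS.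
  apply/bspan_subP => e eF; apply/sub_kermxP; rewrite mulmxBl !vchi.
  suff -> : connect (adj G F) u (target G e) = connect (adj G F) u (source G e).
    by rewrite subrr.
  apply/idP/idP => /connect_trans; apply; last exact: connect_ends.
  by rewrite connect_adjC connect_ends.
move=> /submx_trans/(_ sub_ker) /sub_kermxP; rewrite mulmxBl !vchi connect0 => /eqP.
case: connect => //; rewrite raddf0 sub0r.
by move=> /eqP/matrixP/(_ 0 0); rewrite !mxE.
Qed.

Lemma bd_bspan F e :
  (bd e <= bspan F)%MS = connect (adj G F) (source G e) (target G e).
Proof. by rewrite connect_bspan. Qed.

Let step (p q : V * E) := joins G p.2 p.1 q.1.

(** Chooses edges along a simple path. The fourth clause keeps these edges distinct in the
    induction; the last lets any edge f arriving at x be put in front, which is how a cycle gets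
    closed. *)
Lemma uniq_path_edges F x p : path (adj G F) x p -> uniq (x :: p) ->
  exists c : seq (V * E),
    [/\ unzip1 c = belast x p, {subset unzip2 c <= F}, uniq (unzip2 c),
        (forall e u v, e \in unzip2 c -> joins G e u v -> u \in x :: p)
      & (forall a f g, joins G f a x -> path step (a, f) (rcons c (last x p, g)))].
Proof.
elim: p x => [|y p IH] x.
  move=> _ _; exists [::]; split=> // a f g j /=; by rewrite /step /= j.
rewrite [path _ _ _]/= => /andP[/existsP[e /andP[eF j]] pth] /andP[xyp un].
have [c [c1 cF cu cend cpath]] := IH _ pth un.
exists ((x, e) :: c); split=> /=.
- by rewrite c1.
- by move=> e'; rewrite inE => /predU1P[->|/cF].
- rewrite cu andbT; apply/negP => /cend /(_ j); exact/negP.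
- move=> e' u v; rewrite inE => /predU1P[->|e'c].
    move: j; rewrite /joins => /orP[] /andP[/eqP<- /eqP<-] /orP[] /andP[/eqP-> /eqP->];
    by rewrite !inE eqxx ?orbT.
  by move=> /(cend _ _ _ e'c) h; rewrite inE h orbT.
- move=> a f g ja; rewrite {1}/step /= ja /=; exact: cpath.
Qed.

(** Opens a cycle at its first edge: the remaining edges still connect the far end of that edge to
    its near end. *)
Lemma closed_path_connect F (q z : V * E) (c : seq (V * E)) :
  path step q (rcons c z) -> {subset unzip2 c <= F} ->
  exists2 b, joins G q.2 q.1 b & connect (adj G F) b z.1.
Proof.
elim: c q => [|r c IH] q /=.
  by rewrite andbT => j _; exists z.1.
case/andP => j pth sub; exists r.1 => //.
have [|b rb bz] := IH _ pth; first by move=> e ec; apply: sub; rewrite inE ec orbT.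
apply: connect_trans bz; apply/connect1/(adj_joins _ rb)/sub.
by rewrite inE eqxx.
Qed.

(** A walk between the ends of e avoiding e shortens to a simple path, which e closes to a cycle.
    Conversely, removing one edge of a cycle leaves its ends connected. *)
Lemma forest_bridges F :
  forest G F <->
  forall e, e \in F -> ~~ connect (adj G (F :\ e)) (source G e) (target G e).
Proof.
split=> [forF e eF|brF c].
  apply/negP => /connectP[p0 pth0 lst0].
  case: (shortenP pth0) lst0 => p pth un _ lst.
  have [c [c1 cF cu _ cpath]] := uniq_path_edges pth un.
  apply: (forF ((target G e, e) :: c)); last first.
    by move=> e'; rewrite inE => /predU1P[->//|/cF]; rewrite !inE => /andP[].
  apply/and4P; split=> //=.
  - by rewrite lst c1 -(rcons_uniq) -lastI.
  - by rewrite cu andbT; apply/negP => /cF; rewrite !inE eqxx.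
  - by rewrite lst; apply: cpath; rewrite -lst joinsC joins_ends.
case: c => [|[v e] c] //= /and4P[_ _ /= /andP[ec _] cyc] sub.
have eF : e \in F by apply: sub; rewrite inE eqxx.
have [|b /= j bv] := closed_path_connect (F := F :\ e) cyc.
  move=> e' e'c; rewrite !inE sub ?inE ?e'c ?orbT // andbT.
  by apply: contraNneq ec => <-.
move/negP: (brF e eF); apply; case/orP: j => /andP[/eqP-> /eqP->] //.
by rewrite connect_adjC.
Qed.

Lemma forest_rank F : forest G F <-> \rank (bspan F) = #|F|.
Proof.
rewrite forest_bridges; split=> [brF|rkF e eF]; last first.
  apply/negP; rewrite -bd_bspan => sub.
  have /mxrankS : (bspan F <= bspan (F :\ e))%MS.
    apply/bspan_subP => e' e'F; have [->//|ne] := eqVneq e' e.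
    by apply: bd_sub; rewrite !inE ne.
  move=> /leq_trans/(_ (rank_bspan_le _)); rewrite rkF (cardsD1 e F) eF.
  by rewrite ltnn.
rewrite -boundary_mxE; apply/eqP/inj_row_free => x x0.
apply/rowP => i; rewrite mxE; apply/eqP/negPn/negP => xi.
move: (brF _ (enum_valP i)); rewrite -bd_bspan => /negP; apply.
move: x0; rewrite mulmx_sum_row (bigD1 i) //= => /eqP.
rewrite addr_eq0 => /eqP xi_eq.
rewrite -row_boundary_mx -[row i _]scale1r -(mulVf xi) -scalerA xi_eq.
apply: scalemx_sub; rewrite eqmx_opp; apply: summx_sub => j ji.
apply: scalemx_sub; rewrite row_boundary_mx; apply: bd_sub.
by rewrite !inE enum_valP andbT (inj_eq enum_val_inj).
Qed.

Lemma forest_loop_number F : forest G F <-> loop_number G F = 0%N.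
Proof.
rewrite forest_rank loop_numberE; split=> [->|/eqP]; first exact: subnn.
by rewrite subn_eq0 => le; apply/eqP; rewrite eqn_leq rank_bspan_le.
Qed.

Lemma forestS F F' : F \subset F' -> forest G F' -> forest G F.
Proof. by move=> /subsetP s h c /h nc sub; apply: nc => e /sub /s. Qed.

Lemma forest0 : forest G set0.
Proof. by apply/forest_rank/eqP; rewrite eqn_leq rank_bspan_le cards0. Qed.

End BoundarySpan.

(** * Contractions *)

(* [contracts_to G G' gamma f h]: the vertex map [f] and the edge map [h]
   exhibit [G'] as a copy of the quotient of G by gamma, weights apart.  An
   isomorphism is the case of empty gamma. *)
Definition contracts_to (V E V' E' : finType) (G : wgraph V E)
    (G' : wgraph V' E') (gamma : {set E}) (f : V -> V') (h : E' -> E) : Prop :=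
  [/\ forall u v, (f u == f v) = connect (adj G gamma) u v,
      forall v', exists v, f v = v',
      injective h,
      forall e, (e \in gamma) = (e \notin codom h)
    & forall e', joins G' e' (f (source G (h e'))) (f (target G (h e')))].

Section Contraction.
Variables (V E V' E' : finType) (G : wgraph V E) (G' : wgraph V' E').
Variables (gamma : {set E}) (f : V -> V') (h : E' -> E).
Hypothesis GG' : contracts_to G G' gamma f h.

Let fE u v : (f u == f v) = connect (adj G gamma) u v. Proof. by case: GG'. Qed.
Let h_inj : injective h. Proof. by case: GG'. Qed.

Lemma contracts_to_notin e' : h e' \notin gamma.
Proof. by case: GG' => _ _ _ -> _; rewrite negbK codom_f. Qed.

Lemma contracts_to_edge e : e \notin gamma -> exists e', e = h e'.
Proof. by case: GG' => _ _ _ -> _; rewrite negbK => /codomP. Qed.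

(** The map on 0-chains induced by f. It carries boundary vectors to boundary vectors only up to
    sign, since [contracts_to] ignores orientations. *)
Let push : 'M[rat]_(#|V|, #|V'|) :=
  \matrix_(i, j) (f (enum_val i) == enum_val j)%:R.

Let vtx_push v : vtx v *m push = vtx (f v).
Proof.
rewrite -rowE; apply/rowP => j; rewrite !mxE enum_rankK /=.
by rewrite eq_sym (can2_eq enum_valK enum_rankK).
Qed.

Let bd_push e' : bd G' e' = bd G (h e') *m push \/ bd G' e' = - (bd G (h e') *m push).
Proof.
rewrite /bd mulmxBl !vtx_push; case: GG' => _ _ _ _ /(_ e').
by case/orP=> /andP[/eqP-> /eqP->]; [left | right; rewrite opprB].
Qed.

(** With [pull] choosing a preimage of each vertex, an x killed by [push] equals
    [x *m (1 - push *m pull)], and the rows of that matrix are differences of vertices with equal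
    image, hence connected in gamma. *)
Let ker_push : (kermx push :=: bspan G gamma)%MS.
Proof.
apply/eqmxP/andP; split; last first.
  apply/bspan_subP => e eg; apply/sub_kermxP.
  rewrite /bd mulmxBl !vtx_push.
  by have /eqP -> : f (source G e) == f (target G e); rewrite ?subrr // fE connect_ends.
have sec v' : {v | f v == v'}.
  by apply: sigW; case: GG' => _ /(_ v')[v <-] *; exists v.
pose pull : 'M[rat]_(#|V'|, #|V|) := \matrix_i vtx (sval (sec (enum_val i))).
apply/row_subP => i; set x := row i _.
have x0 : x *m push = 0 by rewrite /x -row_mul mulmx_ker row0.
have -> : x = x *m (1%:M - push *m pull).
  by rewrite mulmxBr mulmx1 mulmxA x0 mul0mx subr0.
apply: mulmx_sub; apply/row_subP => j.
rewrite linearB /= row_mul !rowE mulmx1 -[j]enum_valK -[delta_mx _ _]/(vtx _).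
rewrite vtx_push /vtx -rowE rowK enum_rankK -connect_bspan -fE.
exact: (svalP (sec _)).
Qed.

(** Rank-nullity for [push] on the span of the lifted edges and gamma: the image is the span of F in
    G', the kernel the span of gamma. *)
Lemma contracts_to_rank (F : {set E'}) :
  (\rank (bspan G' F) + \rank (bspan G gamma))%N =
  \rank (bspan G (h @: F :|: gamma)).
Proof.
set A := bspan G (_ :|: _).
have -> : \rank (bspan G gamma) = \rank (A :&: kermx push)%MS.
  rewrite (cap_eqmx (eqmx_refl A) ker_push); apply/eqmx_rank/andP; split.
    by rewrite sub_capmx submx_refl bspanS // subsetUr.
  exact: capmxSr.
rewrite -(mxrank_mul_ker A push); congr addn.
apply/eqmx_rank/andP; split.
  apply/bspan_subP => e eF.
  have sub : (bd G (h e) *m push <= A *m push)%MS.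
    by apply/submxMr/bd_sub; rewrite inE imset_f.
  by case: (bd_push e) => ->; rewrite ?eqmx_opp.
rewrite /A /bspan sumsmxMr_gen; apply/sumsmx_subP => e; rewrite genmxE.
rewrite (eqmxMr _ (genmxE _)) inE => /orP[/imsetP[e' e'F ->]|eg].
  have sub := bd_sub G' e'F.
  case: (bd_push e') sub => ->; by rewrite ?eqmx_opp.
have -> : bd G e *m push = 0; last exact: sub0mx.
by apply/sub_kermxP; rewrite ker_push bd_sub.
Qed.

Lemma card_contracts_to (F : {set E'}) :
  #|h @: F :|: gamma| = (#|F| + #|gamma|)%N.
Proof.
rewrite cardsU (card_imset _ h_inj) (_ : _ :&: _ = set0) ?cards0 ?subn0 //.
apply/setP => e; rewrite !inE; apply/negP => /andP[/imsetP[e' _ ->]].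
exact/negP/contracts_to_notin.
Qed.

Lemma contracts_to_setT : h @: [set: E'] :|: gamma = [set: E].
Proof.
apply/setP => e; rewrite !inE; have [//|/contracts_to_edge[e' ->]] := boolP (e \in gamma).
  by rewrite orbT.
by rewrite imset_f.
Qed.

(** Rank and cardinality are both additive here, so full rank of the union means full rank of both
    parts. *)
Lemma forest_contracts_to (F : {set E'}) :
  forest G (h @: F :|: gamma) <-> forest G gamma /\ forest G' F.
Proof.
split=> [fo|[]]; last first.
  by rewrite !forest_rank -contracts_to_rank card_contracts_to => -> ->.
have fog : forest G gamma by apply: forestS fo; exact: subsetUr.
split=> //; move/forest_rank: fo; rewrite -contracts_to_rank card_contracts_to.
by move/forest_rank: fog => -> /addIn/forest_rank.
Qed.

Lemma loop_number_contracts_to :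
  (loop_number G' [set: E'] + loop_number G gamma)%N = loop_number G [set: E].
Proof.
rewrite !loop_numberE -contracts_to_setT -contracts_to_rank card_contracts_to.
have := rank_bspan_le G' [set: E']; have := rank_bspan_le G gamma.
by move=> ? ?; rewrite addnBA // addnBAC // subnDA.
Qed.

Lemma contracts_to_connected : connected_graph G -> connected_graph G'.
Proof.
case/andP => V0 /forallP con; apply/andP; split.
  by have /card_gt0P[v _] := V0; apply/card_gt0P; exists (f v).
apply/forallP => u'; apply/forallP => v'.
case: GG' => _ fs _ _ j; case: (fs u') => u <-; case: (fs v') => v <-.
have /forallP/(_ v)/connectP[p pth ->] := con u.
elim: p u pth => //= w p IH u /andP[/existsP[e /andP[_ uw]] /IH].
apply: connect_trans; have [eg|/contracts_to_edge[e' ee']] := boolP (e \in gamma).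
  suff /eqP -> : f u == f w by [].
  by rewrite fE; apply/connect1/(adj_joins eg uw).
apply/connect1/(adj_joins (in_setT e')).
move: (j e'); rewrite -ee'.
by case/orP: uw => /andP[/eqP-> /eqP->] //; rewrite joinsC.
Qed.

End Contraction.

Lemma total_weight_eq0 (V E : finType) (G : wgraph V E) :
  total_weight G = 0%N <-> forall v, weight G v = 0%N.
Proof.
split=> [/eqP|h]; last by apply: big1 => v _; exact: h.
by rewrite sum_nat_eq0 => /forallP h v; apply/eqP/(implyP (h v)).
Qed.

(** * Components of the contracted edge set: weights and stability of the quotient *)

Section Components.
Variables (V E : finType) (G : wgraph V E).
Implicit Types (F gamma : {set E}) (u v x : V).

(** A walk in F that starts in a component of gamma never leaves it, so all its edges have both ends
    there. *)
Lemma connect_component F gamma x u v : F \subset gamma -> u \in component G gamma x ->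
  connect (adj G F) u v ->
  connect (adj G (F :&: edges_in G gamma (component G gamma x))) u v.
Proof.
move=> /subsetP Fg xu /connectP[p pth ->] {v}.
elim: p u xu pth => //= w p IH u xu /andP[/existsP[e /andP[eF uw]] pth].
have xw : w \in component G gamma x.
  rewrite !inE in xu *; apply: connect_trans xu _.
  exact/connect1/(adj_joins (Fg _ eF) uw).
apply: connect_trans (IH w xw pth).
apply: connect1; apply: (adj_joins _ uw).
rewrite !inE eF Fg //=; move: xu xw; rewrite !inE => xu xw.
by case/orP: uw => /andP[/eqP-> /eqP->]; rewrite xu xw.
Qed.

Lemma forest_components gamma :
  forest G gamma <->
  forall B, B \in components G gamma -> loop_number G (edges_in G gamma B) = 0%N.
Proof.
split=> [fo B _|h].
  by apply/forest_loop_number; apply: forestS fo; apply/subsetP => e; rewrite inE => /andP[].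
apply/forest_bridges => e eg.
have := h _ (component_in G gamma (source G e)) => /forest_loop_number/forest_bridges/(_ e).
have ein : e \in edges_in G gamma (component G gamma (source G e)).
  by rewrite !inE eg connect0 connect_ends.
move=> /(_ ein); apply: contra => con.
have sin : source G e \in component G gamma (source G e) by rewrite inE connect0.
apply: connect_adjS (connect_component (subD1set gamma e) sin con).
by apply/subsetP => e'; rewrite !in_setI !in_setD1 => /andP[/andP[-> _] ->].
Qed.

(** The boundary vectors of these edges are independent and lie in the span of the [vtx v - vtx x]
    for v in B other than x, of rank at most |B| - 1. *)
Lemma card_forest_component gamma x : forest G gamma ->
  (#|edges_in G gamma (component G gamma x)| < #|component G gamma x|)%N.
Proof.
set B := component _ _ _ => fo.
have /forest_rank <- : forest G (edges_in G gamma B).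
  by apply: forestS fo; apply/subsetP => e; rewrite inE => /andP[].
have xB : x \in B by rewrite inE connect0.
rewrite [X in (_ < X)%N](cardsD1 x) xB ltnS.
pose S := (\sum_(v in B :\ x) <<vtx v - vtx x>>)%MS.
have subS v : v \in B -> (vtx v - vtx x <= S)%MS.
  move=> vB; have [->|ne] := eqVneq v x; first by rewrite subrr sub0mx.
  by apply: (sumsmx_sup v); rewrite ?in_setD1 ?ne ?vB // genmxE.
have /mxrankS/leq_trans : (bspan G (edges_in G gamma B) <= S)%MS.
  apply/bspan_subP => e; rewrite inE => /and3P[_ sB tB].
  rewrite /bd -(subrKA (vtx x)); apply: addmx_sub; first exact: subS.
  by rewrite -opprB eqmx_opp subS.
apply; rewrite -sum1_card /S.
elim/big_rec2: _ => [|v n A _ le]; first by rewrite mxrank0.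
apply: leq_trans (mxrank_adds_leqif _ _) _; apply: leq_add le.
by rewrite genmxE rank_leq_row.
Qed.

(** The loop numbers added to the weights all vanish exactly when gamma is a forest, so a gluing
    that stays in weight 0 contracts a forest. *)
Lemma total_weight_contraction gamma :
  total_weight (contraction G gamma) = 0%N <->
  total_weight G = 0%N /\ forest G gamma.
Proof.
rewrite (total_weight_eq0 G) (total_weight_eq0 (contraction _ _)).
rewrite forest_components; split=> [h|[w0 fo] [B Bin]] /=.
  split=> [v|B Bin]; last first.
    by have /eqP := h (exist _ B Bin); rewrite /= addn_eq0 => /andP[/eqP].
  have /eqP := h (to_component G gamma v); rewrite /= addn_eq0 sum_nat_eq0.
  case/andP => _ /forallP/(_ v)/implyP h'.
  by apply/eqP/h'; rewrite inE connect0.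
by rewrite fo // big1.
Qed.

Lemma valencyE v :
  valency G v = (\sum_e ((source G e == v) + (target G e == v)))%N.
Proof.
rewrite big_split /=; congr addn; rewrite -sum1_card.
  by rewrite [RHS]big_mkcond [LHS]big_mkcond; apply: eq_bigr => e _; rewrite inE; case: eqP.
by rewrite [RHS]big_mkcond [LHS]big_mkcond; apply: eq_bigr => e _; rewrite inE; case: eqP.
Qed.

End Components.

(* A tree component B of gamma has |B| - 1 edges, so the valency of its image
   is at least 3 |B| - 2 (|B| - 1). *)
Lemma contracts_to_stable (V E V' E' : finType) (G : wgraph V E)
    (G' : wgraph V' E') (gamma : {set E}) (f : V -> V') (h : E' -> E) :
  contracts_to G G' gamma f h -> forest G gamma ->
  total_weight G = 0%N -> stable G -> stable G'.
Proof.
move=> GG' fo /total_weight_eq0 w0 /forallP st; apply/forallP => v'.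
apply: (leq_trans _ (leq_addl _ _)).
have [fE fs hi gE j] := GG'.
have [x fx] := fs v'; pose B := component G gamma x.
have BE v : (v \in B) = (f v == v') by rewrite inE -fx -fE eq_sym.
have val_ge : (3 * #|B| <= \sum_(v in B) valency G v)%N.
  rewrite mulnC -sum_nat_const; apply: leq_sum => v _.
  by have := st v; rewrite w0.
have fsum u (P : pred V) : P u = true -> (\sum_(v | P v) (u == v) = 1)%N.
  by move=> Pu; rewrite (bigD1 u) //= eqxx big1 // => v /andP[_ /negbTE]; rewrite eq_sym => ->.
have sum_eq u : (\sum_(v in B) (u == v) = (f u == v'))%N.
  rewrite -BE; have [uB|uB] := boolP (u \in B); first exact: fsum.
  by rewrite big1 // => v vB; case: eqP => // uv; rewrite uv vB in uB.
have sumE : (\sum_(v in B) valency G v =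
             \sum_e ((f (source G e) == v') + (f (target G e) == v')))%N.
  under eq_bigr => v _ do rewrite valencyE.
  by rewrite exchange_big /=; apply: eq_bigr => e _; rewrite big_split /= !sum_eq.
(* An edge of gamma has both ends in B or none, and counts twice if in B; an edge outside gamma is
   one of G' and contributes its ends at v'. *)
have : (\sum_(v in B) valency G v = 2 * #|edges_in G gamma B| + valency G' v')%N.
  rewrite sumE (bigID (mem gamma)) /=; congr addn.
    rewrite mulnC -sum_nat_const big_mkcond [RHS]big_mkcond /=; apply: eq_bigr => e _.
    rewrite inE !BE; case: ifP => //= eg.
    have /eqP -> : f (source G e) == f (target G e) by rewrite fE connect_ends.
    by rewrite andbb; case: eqP.
  rewrite valencyE; under eq_bigl => e do rewrite gE negbK.
  have -> : (\sum_(e in codom h) ((f (source G e) == v') + (f (target G e) == v')) =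
    \sum_(e in h @: [set: E']) ((f (source G e) == v') + (f (target G e) == v')))%N.
    apply: eq_bigl => e; apply/codomP/imsetP => [[e' ->]|[e' _ ->]]; last by exists e'.
    by exists e'.
  rewrite big_imset /=; last exact: in2W.
  rewrite big_mkcond; apply: eq_bigr => e' _; rewrite in_setT.
  by case/orP: (j e') => /andP[/eqP-> /eqP->]; rewrite // addnC.
have := card_forest_component x fo; rewrite -/B.
by lia.
Qed.

(** * Gluing maps as contractions, and labelled copies of quotients *)

Lemma contracts_to_iso (V E V' E' : finType) (G : wgraph V E)
    (G' : wgraph V' E') (phi : wgraph_iso G G') :
  exists2 h, contracts_to G G' set0 (iso_vertex phi) h &
    forall e, h (iso_edge phi e) = e.
Proof.
have [h eK hK] := iso_edge_bij phi; exists h => //; split.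
- move=> u v; rewrite (inj_eq (bij_inj (iso_vertex_bij phi))).
  apply/eqP/idP => [->|]; first exact: connect0.
  case/connectP => -[|w p] /=; first by move=> _ ->.
  by case/andP=> /existsP[e]; rewrite inE.
- by move=> v'; have [k _ kK] := iso_vertex_bij phi; exists (k v').
- exact: can_inj hK.
- move=> e; rewrite inE; apply/esym/negbTE; rewrite negbK.
  by apply/codomP; exists (iso_edge phi e); rewrite eK.
- by move=> e'; have := iso_joins phi (h e'); rewrite hK.
Qed.

Lemma contracts_to_contraction (V E V' E' : finType) (G : wgraph V E)
    (gamma : {set E}) (G' : wgraph V' E')
    (phi : wgraph_iso (contraction G gamma) G') :
  exists2 h, contracts_to G G' gamma (iso_vertex phi \o to_component G gamma) h &
    forall e : contract_edge gamma, h (iso_edge phi e) = val e.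
Proof.
have [h eK hK] := iso_edge_bij phi.
exists (val \o h) => [|e] /=; last by rewrite eK.
split.
- move=> u v /=; rewrite (inj_eq (bij_inj (iso_vertex_bij phi))) -val_eqE /=.
  apply/eqP/idP => [/setP/(_ v)|con]; first by rewrite !inE connect0.
  apply/setP => w; rewrite !inE; apply/idP/idP; apply: connect_trans => //.
  by rewrite connect_adjC.
- move=> v'; have [k _ kK] := iso_vertex_bij phi.
  have /imsetP[v _ kv] := valP (k v'); exists v => /=; rewrite -[RHS]kK.
  by congr iso_vertex; apply: val_inj.
- exact: inj_comp val_inj (can_inj hK).
- move=> e; apply/idP/idP => [eg|].
    apply/negP => /codomP[e' ee']; move: eg; rewrite ee'.
    exact/negP/(valP (h e')).
  apply: contraNT => eg; apply/codomP; exists (iso_edge phi (exist _ e eg)) => /=.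
  by rewrite eK.
- by move=> e' /=; have := iso_joins phi (h e'); rewrite hK.
Qed.

Lemma total_weight_iso (V E V' E' : finType) (G : wgraph V E)
    (G' : wgraph V' E') (phi : wgraph_iso G G') :
  total_weight G' = total_weight G.
Proof.
rewrite /total_weight (reindex (iso_vertex phi)) /=; last exact/onW_bij/iso_vertex_bij.
by apply: eq_bigr => v _; rewrite iso_weight.
Qed.

(** Points of the moduli space live over graphs with ordinal vertex and edge sets, which quotients
    do not have. *)
Definition relabel (V E : finType) (G : wgraph V E) : lgraph :=
  @LGraph #|V| #|E|
    {| source := fun i => enum_rank (source G (enum_val i));
       target := fun i => enum_rank (target G (enum_val i));
       weight := fun j => weight G (enum_val j) |}.

Lemma relabel_iso (V E : finType) (G : wgraph V E) : wgraph_iso G (relabel G).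
Proof.
apply: (@WGraphIso _ _ _ _ G (relabel G) (@enum_rank V) (@enum_rank E)).
- exact: enum_rank_bij.
- exact: enum_rank_bij.
- by move=> e; rewrite /joins /= enum_rankK !eqxx.
- by move=> v /=; rewrite enum_rankK.
Qed.

(** Contracting a forest loses no loops and properness leaves an edge, so the quotient indexes a
    simplex of the same moduli space. *)
Lemma relabel_contraction_stable g (G : lgraph) (gamma : {set 'I_(nedge G)}) :
  stable_of_genus g G -> total_weight G = 0%N -> gamma \proper [set: _] ->
  forest G gamma -> stable_of_genus g (relabel (contraction G gamma)).
Proof.
move=> /and4P[con st /eqP gG _] w0 /properP[_ [e0 _ e0g]] fo.
have [h ctr _] := contracts_to_contraction (relabel_iso (contraction G gamma)).
apply/and4P; split.
- exact: contracts_to_connected ctr con.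
- exact: contracts_to_stable ctr fo w0 st.
- have w0' : total_weight (contraction G gamma) = 0%N.
    exact/total_weight_contraction.
  rewrite /genus (total_weight_iso (relabel_iso _)) w0' addn0 -gG /genus w0 addn0.
  rewrite -(loop_number_contracts_to ctr).
  by move/forest_loop_number: fo => ->; rewrite addn0.
- by apply/card_gt0P; exists (exist _ e0 e0g).
Qed.

From mathcomp Require Import all_classical all_reals all_analysis lra.
Import numFieldNormedType.Exports.
Local Open Scope classical_set_scope.

(** * The threshold level of a length function *)

Section Threshold.
Variables (R : realType) (n : nat).
Implicit Types (V : finType) (x : 'I_n -> R).

(* The largest level c <= 1 such that the edges shorter than c form a forest. *)
Definition threshold V (G : wgraph V 'I_n) x : R :=
  \big[Order.min/1]_(C : {set 'I_n} | ~~ `[< forest G C >])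
    \big[Order.max/0]_(e in C) x e.

(** Why the min-max formula gives the level: for c > 0, the edges shorter than c form a forest iff
    every non-forest has an edge of length at least c. *)
Lemma threshold_geP V (G : wgraph V 'I_n) x c :
  reflect (c <= 1 /\ forall C : {set 'I_n}, ~ forest G C ->
                       c <= \big[Order.max/0]_(e in C) x e)
          (c <= threshold G x).
Proof.
apply: (iffP (bigmin_geP _ _ _ _)) => -[c1 h]; split=> // C.
  by move=> nC; apply: h; apply/negP => /asboolP.
by move=> /negP nC; apply: h => /asboolP.
Qed.

Lemma threshold_le V (G : wgraph V 'I_n) x (C : {set 'I_n}) : ~ forest G C ->
  threshold G x <= \big[Order.max/0]_(e in C) x e.
Proof. by move/(threshold_geP _ _ _ (lexx _)).2. Qed.

Lemma threshold_ge0 V (G : wgraph V 'I_n) x : 0 <= threshold G x.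
Proof. by apply/threshold_geP; split=> // C _; exact: bigmax_ge_id. Qed.

Lemma threshold_gt0 V (G : wgraph V 'I_n) x :
  forest G [set e | x e <= 0]%SET -> 0 < threshold G x.
Proof.
move=> fo; apply/bigmin_gtP; split=> // C /negP nC.
rewrite ltNge; apply/negP => /bigmax_leP[_ le]; apply/nC/asboolP.
by apply: forestS fo; apply/fintype.subsetP => e /le; rewrite inE.
Qed.

Lemma forest_threshold V (G : wgraph V 'I_n) x : 0 < threshold G x ->
  forest G [set e | x e < threshold G x]%SET.
Proof.
move=> gt0; apply: contrapT => /(@threshold_le _ _ x); rewrite leNgt => /negP; apply.
(* The maximum starts at 0, so bounding it strictly also takes positivity of the threshold. *)
by apply/bigmax_ltP; split=> // e; rewrite inE.
Qed.

End Threshold.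

(** Non-forests C' of G' lift to [h @: C' :|: gamma], and non-forests of G pull back along h to
    non-forests; edges of gamma have length 0, the default of the maximum, and do not raise it. *)
Lemma threshold_contracts_to (R : realType) (n n' : nat) (V V' : finType)
    (G : wgraph V 'I_n) (G' : wgraph V' 'I_n') gamma f h
    (x : 'I_n -> R) (x' : 'I_n' -> R) :
  contracts_to G G' gamma f h -> forest G gamma ->
  (forall e, e \in gamma -> x e = 0) -> (forall e', x' e' = x (h e')) ->
  threshold G x = threshold G' x'.
Proof.
move=> ctr fo x0 xx'; apply: le_anti; apply/andP; split.
  apply/threshold_geP; split=> [|C' nC']; first exact: bigmin_le_id.
  apply: le_trans (threshold_le (C := h @: C' :|: gamma) _ _) _.
    by move=> /(forest_contracts_to ctr)[].
  apply/bigmax_leP; split=> [|e]; first exact: bigmax_ge_id.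
  rewrite inE => /orP[/imsetP[e' e'C ->]|/x0->]; last exact: bigmax_ge_id.
  by rewrite -xx'; exact: le_bigmax_cond.
apply/threshold_geP; split=> [|C nC]; first exact: bigmin_le_id.
apply: le_trans (threshold_le (C := h @^-1: C) _ _) _.
  move=> foC; apply: nC.
  have : forest G (h @: (h @^-1: C) :|: gamma) by apply/(forest_contracts_to ctr).
  apply: forestS; apply/fintype.subsetP => e eC; rewrite inE orbC.
  have [//|/(contracts_to_edge ctr)[e' ee']] := boolP (e \in gamma).
  by rewrite ee' imset_f // inE -ee'.
apply/bigmax_leP; split=> [|e']; first exact: bigmax_ge_id.
by rewrite inE xx' => hC; exact: le_bigmax_cond.
Qed.

(** * The flow to the spine *)

Section Flow.
Variables (R : realType) (g : nat).
Implicit Types (p q : simplices R g).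

Lemma len_ge0 p e : 0 <= len (p := p) e.
Proof. by case: p e => G [x xs] e; rewrite /len /=; case: (set_mem xs). Qed.

Lemma sum_len p : \sum_e len (p := p) e = 1.
Proof. by case: p => G [x xs]; rewrite /len /=; case: (set_mem xs). Qed.

Lemma len_le1 p e : len (p := p) e <= 1.
Proof.
rewrite -(sum_len p) (bigD1 e) //= lerDl; apply: sumr_ge0 => i _; exact: len_ge0.
Qed.

Lemma len_gt0 p : exists e, 0 < len (p := p) e.
Proof.
apply: contrapT => /forallNP h; have := sum_len p.
rewrite big1 => [/eqP|e _]; first by rewrite eq_sym oner_eq0.
by apply/eqP; rewrite eq_le len_ge0 andbT leNgt; exact/negP.
Qed.

(** Puts both gluing moves into one form, isomorphisms having empty gamma, so that invariance is
    checked once. *)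
Lemma MG_step_contracts_to p q : MG_step p q -> exists gamma f h,
  [/\ contracts_to (gr p) (gr q) gamma f h,
      forall e, e \in gamma -> len e = 0,
      forall e', len (p := q) e' = len (h e')
    & total_weight (gr q) = 0%N <-> total_weight (gr p) = 0%N /\ forest (gr p) gamma].
Proof.
case=> [[gamma [_ x0 [phi xx']]]|[phi xx']].
  have [h ctr hK] := contracts_to_contraction phi.
  exists gamma, (iso_vertex phi \o to_component (gr p) gamma), h; split=> // [e'|].
    by have [k kK eK] := iso_edge_bij phi; rewrite -(eK e') xx' hK.
  by rewrite (total_weight_iso phi); exact: total_weight_contraction.
have [h ctr hK] := contracts_to_iso phi.
exists finset.set0, (iso_vertex phi), h; split=> // [e|e'|]; first by rewrite inE.
  by have [k kK eK] := iso_edge_bij phi; rewrite -(eK e') xx' hK.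
by rewrite (total_weight_iso phi); split=> [->|[]//]; split=> //; exact: forest0.
Qed.

(** The points lying over MG_g^0, as [MG0P] shows; unlike positivity of all lengths, this condition
    is invariant under gluing. *)
Definition good p : Prop :=
  total_weight (gr p) = 0%N /\ forest (gr p) [set e | len e <= 0]%SET.

Lemma MG_step_good p q : MG_step p q -> good p <-> good q.
Proof.
move=> /MG_step_contracts_to[gamma [f [h [ctr x0 xx' tw]]]].
rewrite /good tw.
(* The zero edges of p are gamma together with the lifts of the zero edges of q. *)
have -> : [set e | len (p := p) e <= 0]%SET =
          (h @: [set e | len (p := q) e <= 0] :|: gamma)%SET.
  apply/setP => e; rewrite !inE orbC.
  have [eg|/(contracts_to_edge ctr)[e' ->]] := boolP (e \in gamma).
    by rewrite x0 // lexx.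
  rewrite mem_imset; last by case: ctr.
  by rewrite inE xx'.
by rewrite (forest_contracts_to ctr); tauto.
Qed.

(** Extends the flow to all real times, so that continuity at 0 and 1 can be treated on full
    neighbourhoods. *)
Definition clamp (t : R) : R := Order.max 0 (Order.min 1 t).

Lemma clamp_itv t : 0 <= clamp t <= 1.
Proof. by rewrite /clamp le_max lexx /= ge_max ler01 ge_min lexx. Qed.

Definition cut_at (s t r : R) : R := (1 - clamp t) * r + clamp t * Order.min r s.

(** This lower bound keeps positive lengths positive along the flow, so no new zero edges appear. *)
Lemma min_le_cut s t r : Order.min r s <= cut_at s t r.
Proof.
have /andP[c0 c1] := clamp_itv t.
have : (1 - clamp t) * Order.min r s <= (1 - clamp t) * r.
  by rewrite ler_wpM2l ?ge_min ?lexx // subr_ge0.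
by rewrite /cut_at; lra.
Qed.

Definition flow_vec (G : lgraph) (x : 'rV[R]_(nedge G)) (t : R) : 'rV[R]_(nedge G) :=
  let y e := cut_at (threshold G (x ord0)) t (x ord0 e) in
  (\sum_e y e)^-1 *: \row_e y e.

Definition flow_at (G : lgraph) (x : simplex_space R G) (t : R) :
    simplex_space R G :=
  insubd x (flow_vec (set_val x) t).

(* Off the good locus the cut lengths may all vanish; there the flow is
   constant. *)
Definition flow p t : simplices R g :=
  existT _ (projT1 p) (flow_at (projT2 p) t).

Definition flow_len p t (e : 'I_(nedge (gr p))) : R :=
  cut_at (threshold (gr p) (@len R g p)) t (len e).

Lemma flow_len_gt0 p t e : good p -> 0 < len e -> 0 < flow_len (p := p) t e.
Proof.
move=> [_ fo] e0; apply: lt_le_trans (min_le_cut _ _ _).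
by rewrite lt_min e0 threshold_gt0.
Qed.

Lemma flow_len_ge0 p t e : 0 <= flow_len (p := p) t e.
Proof.
apply: le_trans (min_le_cut _ _ _).
by rewrite le_min len_ge0 threshold_ge0.
Qed.

Lemma sum_flow_len_gt0 p t : good p -> 0 < \sum_e flow_len (p := p) t e.
Proof.
move=> gp; have [e e0] := len_gt0 p.
rewrite (bigD1 e) //=; apply: ltr_pwDl; first exact: flow_len_gt0.
by apply: sumr_ge0 => i _; exact: flow_len_ge0.
Qed.

Lemma flow_vec_simplex p t : good p ->
  simplex (flow_vec (set_val (projT2 p : set_type (@simplex R (gr p)))) t).
Proof.
move=> gp; have s0 := sum_flow_len_gt0 t gp; split=> [e|].
  by rewrite !mxE mulr_ge0 ?invr_ge0 ?(ltW s0) // flow_len_ge0.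
under eq_bigr => e _ do rewrite !mxE.
by rewrite -mulr_sumr mulVf // gt_eqF.
Qed.

Lemma len_flow p t e : good p ->
  len (p := flow p t) e = (\sum_i flow_len (p := p) t i)^-1 * flow_len (p := p) t e.
Proof.
move=> gp; rewrite /len /= set_valE /flow_at val_insubd.
have /mem_set -> := flow_vec_simplex t gp.
by rewrite !mxE.
Qed.

Lemma good_flow p t : good p -> good (flow p t).
Proof.
move=> gp; have [w0 fo] := gp; split=> //; apply: forestS fo.
apply/fintype.subsetP => e; rewrite !inE len_flow //; apply: contraLR; rewrite -!ltNge => e0.
by rewrite mulr_gt0 ?invr_gt0 ?sum_flow_len_gt0 // flow_len_gt0.
Qed.

Lemma flow_id p t : good p -> (forall e, flow_len (p := p) t e = len e) -> flow p t = p.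
Proof.
case: p => G x gp h; congr existT; apply: val_inj.
rewrite val_insubd (mem_set (flow_vec_simplex t gp)).
apply/rowP => e; have := @len_flow _ t e gp.
rewrite /len /= set_valE /flow_at val_insubd (mem_set (flow_vec_simplex t gp)) => ->.
rewrite h; under eq_bigr => i _ do rewrite h.
by rewrite sum_len invr1 mul1r.
Qed.

Lemma flow0 p : good p -> flow p 0 = p.
Proof.
move=> gp; apply: flow_id => // e; rewrite /flow_len /cut_at /clamp.
by rewrite min_r ?ler01 // maxxx subr0 mul1r mul0r addr0.
Qed.

(** The thresholds agree and contracted edges stay at length 0, so the totals agree too; the same
    contraction or isomorphism then glues the flowed points. *)
Lemma MG_step_flow p q t : good p -> MG_step p q -> MG_step (flow p t) (flow q t).
Proof.
move=> gp st; have gq := (MG_step_good st).1 gp.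
have [gamma [f [h [ctr x0 xx' tw]]]] := MG_step_contracts_to st.
have fo : forest (gr p) gamma by case: gq => /tw[].
have thr : threshold (gr p) (@len R g p) = threshold (gr q) (@len R g q).
  exact: threshold_contracts_to ctr fo x0 xx'.
have fl0 e : len (p := p) e = 0 -> flow_len t e = 0.
  move=> e0; rewrite /flow_len /cut_at e0 min_l ?threshold_ge0 //.
  by rewrite !mulr0 addr0.
have flE e e' : len (p := q) e' = len (p := p) e -> flow_len t e' = flow_len t e.
  by move=> ee'; rewrite /flow_len ee' thr.
have sums : \sum_e flow_len (p := p) t e = \sum_e' flow_len (p := q) t e'.
  transitivity (\sum_(e in h @: [set: _]%SET) flow_len (p := p) t e).
    rewrite [RHS]big_mkcond; apply: eq_bigr => e _.
    case: ifP => // /negbT he; apply: fl0; apply: x0.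
    apply: contraNT he => /(contracts_to_edge ctr)[e' ->]; exact: imset_f.
  rewrite big_imset /=; last by case: ctr => _ _ hi _ _; exact: in2W.
  by apply: eq_big => [e'|e' _]; rewrite ?inE // -(flE (h e') e').
have lenE e e' : len (p := q) e' = len (p := p) e ->
    len (p := flow q t) e' = len (p := flow p t) e.
  by move=> ee'; rewrite !len_flow // sums (flE _ _ ee').
case: st => [[delta [dp d0 [phi dphi]]]|[phi dphi]].
  left; exists delta; split=> // [e ed|]; last first.
    by exists phi => e; exact: lenE (dphi e).
  by rewrite len_flow // fl0 ?mulr0 // d0.
by right; exists phi => e; exact: lenE (dphi e).
Qed.

Lemma MG_equiv_good p q : MG_equiv p q -> good p <-> good q.
Proof.
move=> /asboolP; elim=> {p q} [p q /MG_step_good//|p|p q _|p r q _ pr _ rq] //.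
  by move=> ->.
by rewrite pr.
Qed.

Lemma MG_equiv_flow p q t : good p -> MG_equiv p q -> MG_equiv (flow p t) (flow q t).
Proof.
move=> gp /asboolP pq; elim: pq gp => {p q} [p q st gp|p gp|p q pq IH gq|p r q pr IH1 rq IH2 gp].
- by apply/asboolP/rst_step/MG_step_flow.
- exact: MG_equiv_refl.
- by rewrite MG_equiv_sym IH //; apply/(MG_equiv_good (p := p) (q := q)) => //; exact/asboolP.
- apply: MG_equiv_trans (IH1 gp) (IH2 _).
  by apply/(MG_equiv_good (p := p) (q := r)) => //; exact/asboolP.
Qed.

Lemma MG_classP p q : MG_class p = MG_class q <-> MG_equiv p q.
Proof. by split=> [/eqmodP//|pq]; apply/eqmodP. Qed.

(** A good point is glued to one with all lengths positive by contracting its zero edges, which form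
    a proper subset because the lengths sum to 1. *)
Lemma MG0P p : MG0 R g (MG_class p) <-> good p.
Proof.
split=> [[q [q0 w0] /MG_classP/MG_equiv_good <-]|gp].
  split=> //; suff -> : [set e | len (p := q) e <= 0]%SET = finset.set0 by exact: forest0.
  by apply/setP => e; rewrite !inE leNgt q0.
have [w0 fo] := gp; pose gamma := [set e | len (p := p) e <= 0]%SET.
have gprop : (gamma \proper [set: _])%SET.
  have [e e0] := len_gt0 p; apply/properP; split; first exact: finset.subsetT.
  by exists e; rewrite ?inE // -ltNge.
have x0 e : e \in gamma -> len (p := p) e = 0.
  by rewrite inE => le; apply/eqP; rewrite eq_le le len_ge0.
have st := relabel_contraction_stable (valP (projT1 p)) w0 gprop fo.
pose phi := relabel_iso (Defs.contraction (gr p) gamma).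
have [h ctr hK] := contracts_to_contraction phi.
pose y : 'rV[R]_(nedge (relabel (Defs.contraction (gr p) gamma))) := \row_e' len (h e').
have ys : simplex y.
  split=> [e'|]; first by rewrite mxE len_ge0.
  under eq_bigr => e' _ do rewrite mxE.
  rewrite -(sum_len p) [RHS](bigID (mem gamma)) /= [X in X + _]big1 ?add0r //.
  transitivity (\sum_(e in h @: [set: _]%SET) len (p := p) e).
    rewrite big_imset /=; last by case: ctr => _ _ hi _ _; exact: in2W.
    by apply: eq_bigl => e'; rewrite inE.
  apply: eq_bigl => e; apply/imsetP/idP => [[e' _ ->]|].
    exact: contracts_to_notin ctr e'.
  by case/(contracts_to_edge ctr) => e' ->; exists e'.
pose q : simplices R g :=
  existT _ (exist _ (relabel (Defs.contraction (gr p) gamma)) st : stable_graph g)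
    (exist _ y (mem_set ys) : simplex_space R _).
have lq e' : len (p := q) e' = len (h e') by rewrite /len /= mxE.
have pq : MG_step p q.
  left; exists gamma; split=> //; exists phi => e.
  by rewrite lq hK.
exists q; last by apply/MG_classP; rewrite MG_equiv_sym; apply/asboolP/rst_step.
split=> [e'|].
  by rewrite lq ltNge; have := contracts_to_notin ctr e'; rewrite inE.
rewrite (total_weight_iso phi); exact/total_weight_contraction.
Qed.

(** Any edge outside F has maximal length, which is positive, so the zero edges lie in F. *)
Lemma in_cube_good p (F : {set 'I_(nedge (gr p))}) :
  total_weight (gr p) = 0%N -> forest (gr p) F -> in_cube F -> good p.
Proof.
move=> w0 fo [eqF leF]; split=> //; apply: forestS fo; apply/fintype.subsetP => e.
rewrite inE; apply: contraLR => eF; rewrite -ltNge.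
have [i i0] := len_gt0 p; apply: (lt_le_trans i0).
by have [iF|iF] := boolP (i \in F); [exact: leF | rewrite (eqF i e)].
Qed.

(** A non-forest is not contained in F, so it has an edge of maximal length; thus no length exceeds
    the threshold and cutting changes nothing. *)
Lemma in_cube_flow p (F : {set 'I_(nedge (gr p))}) t :
  total_weight (gr p) = 0%N -> forest (gr p) F -> in_cube F -> flow p t = p.
Proof.
move=> w0 fo cu; apply: flow_id; first exact: in_cube_good cu.
move=> e; rewrite /flow_len /cut_at min_l; first by rewrite -mulrDl subrK mul1r.
apply/threshold_geP; split=> [|C nC]; first exact: len_le1.
have [i iC iF] : exists2 i, i \in C & i \notin F.
  apply: contrapT => h; apply: nC; apply: forestS fo; apply/fintype.subsetP => i iC.
  by apply: contrapT => /negP iF; apply: h; exists i.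
apply: le_trans (le_bigmax_cond _ _ iC); case: cu => eqF leF.
by have [eF|eF] := boolP (e \in F); [exact: leF | rewrite (eqF e i)].
Qed.

Lemma spine_flow1 p : good p -> spine R g (MG_class (flow p 1)).
Proof.
move=> gp; have [w0 fo] := gp; exists (flow p 1) => //; split=> //.
have s0 := sum_flow_len_gt0 1 gp.
exists [set e | len (p := p) e < threshold (gr p) (@len R g p)]%SET; split.
  exact/forest_threshold/threshold_gt0.
have fl e : flow_len (p := p) 1 e = Order.min (len e) (threshold (gr p) (@len R g p)).
  by rewrite /flow_len /cut_at /clamp minxx max_r ?ler01 // subrr mul0r add0r mul1r.
split=> [i j|k i]; rewrite !inE -?leNgt => ki kj; rewrite !len_flow // !fl.
  by rewrite !min_r.
by rewrite ler_pM2l ?invr_gt0 // [leRHS]min_r // ge_min lexx orbT.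
Qed.

End Flow.

(** * Continuity *)

Lemma cvg_mx (R : realType) (T : Type) (F : set_system T) (FF : Filter F) (m n : nat)
    (f : T -> 'M[R]_(m, n)) (M : 'M[R]_(m, n)) :
  (forall i j, f x i j @[x --> F] --> M i j) -> f x @[x --> F] --> M.
Proof.
move=> fM A [P MP sPA]; apply: filterS (sPA) _.
by apply: filter_forall => i; apply: filter_forall => j; exact: fM.
Qed.

Section FlowContinuity.
Variables (R : realType) (g : nat).

Section Filter.
Variables (T : Type) (F : set_system T).
Context {FF : Filter F}.

Lemma cvg_minr (u v : T -> R) (a b : R) : u x @[x --> F] --> a -> v x @[x --> F] --> b ->
  Order.min (u x) (v x) @[x --> F] --> Order.min a b.
Proof. by move=> ua vb; apply: continuous2_cvg ua vb; exact: (@min_continuous _ R (a, b)). Qed.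

Lemma cvg_maxr (u v : T -> R) (a b : R) : u x @[x --> F] --> a -> v x @[x --> F] --> b ->
  Order.max (u x) (v x) @[x --> F] --> Order.max a b.
Proof. by move=> ua vb; apply: continuous2_cvg ua vb; exact: (@max_continuous _ R (a, b)). Qed.

Lemma cvg_threshold n (V : finType) (G : wgraph V 'I_n) (x : T -> 'I_n -> R) x0 :
  (forall e, x a e @[a --> F] --> x0 e) ->
  threshold G (x a) @[a --> F] --> threshold G x0.
Proof.
move=> xx0; apply: cvg_big => [|C _]; first exact: min_continuous.
by apply: cvg_big => [|e _]; [exact: max_continuous | exact: xx0].
Qed.

Lemma cvg_cut (s t r : T -> R) (s0 t0 r0 : R) :
  s a @[a --> F] --> s0 -> t a @[a --> F] --> t0 -> r a @[a --> F] --> r0 ->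
  cut_at (s a) (t a) (r a) @[a --> F] --> cut_at s0 t0 r0.
Proof.
move=> ss tt rr.
have cl : clamp (t a) @[a --> F] --> clamp t0.
  by apply: cvg_maxr; [exact: cvg_cst | apply: cvg_minr; [exact: cvg_cst |]].
apply: cvgD; apply: cvgM => //; last exact: cvg_minr.
by apply: cvgB => //; exact: cvg_cst.
Qed.

Lemma cvg_flow_vec (G : lgraph) (x : T -> 'rV[R]_(nedge G)) (t : T -> R)
    (x0 : 'rV[R]_(nedge G)) (t0 : R) :
  x a @[a --> F] --> x0 -> t a @[a --> F] --> t0 ->
  \sum_e cut_at (threshold G (x0 ord0)) t0 (x0 ord0 e) != 0 ->
  flow_vec (x a) (t a) @[a --> F] --> flow_vec x0 t0.
Proof.
move=> xx0 tt0 s0.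
have xe e : x a ord0 e @[a --> F] --> x0 ord0 e.
  exact: (cvg_comp _ _ xx0 (@coord_continuous R 1 (nedge G) ord0 e x0)).
have ce e : cut_at (threshold G (x a ord0)) (t a) (x a ord0 e) @[a --> F] -->
            cut_at (threshold G (x0 ord0)) t0 (x0 ord0 e).
  by apply: cvg_cut => //; exact: cvg_threshold.
apply: cvg_mx => i e; rewrite !mxE.
under eq_cvg => a do rewrite !mxE.
by apply: cvgM => //; apply: cvgV => //; apply: cvg_big => //; exact: add_continuous.
Qed.

End Filter.

Definition vec (G : lgraph) (x : simplex_space R G) : 'rV[R]_(nedge G) :=
  set_val (x : set_type (@simplex R G)).

Lemma continuous_vec G : continuous (@vec G).
Proof. exact: initial_continuous. Qed.

Lemma cvg_vec_coord (G : lgraph) (x : simplex_space R G) e :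
  vec y ord0 e @[y --> x] --> vec x ord0 e.
Proof.
exact: (cvg_comp _ _ (@continuous_vec G x) (@coord_continuous R 1 (nedge G) ord0 e (vec x))).
Qed.

(** Positive coordinates stay positive nearby, so the set of zero edges can only shrink, and subsets
    of forests are forests. *)
Lemma good_near (p : simplices R g) : good p -> \forall q \near p, good q.
Proof.
case: p => G x [w0 fo].
suff : \forall y \near x, good (existT _ G y : simplices R g) by [].
suff : \forall y \near x, forall e, 0 < vec x ord0 e -> 0 < vec y ord0 e.
  apply: filterS => y pos; split=> //; apply: forestS fo.
  apply/fintype.subsetP => e; rewrite !inE; apply: contraLR.
  by rewrite -!ltNge; exact: pos.
apply: (@filter_forall _ _ (fun e (y : simplex_space R (val G)) =>
  0 < vec x ord0 e -> 0 < vec y ord0 e) (nbhs x)) => e.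
have [e0|e0] := ltP 0 (vec x ord0 e).
  by apply: filterS (cvgr_gt _ (cvg_vec_coord (x := x) (e := e)) _ e0).
exact: nearW.
Qed.

(** [flow_at] is given by [flow_vec] on the good locus, which is open, so the limit can be taken in
    the ambient vector space. *)
Lemma cvg_flow (p : simplices R g) (t : R) : good p ->
  flow z.2 z.1 @[z --> (t, p)] --> flow p t.
Proof.
case: p => G x gp.
suff h : flow_at z.2 z.1 @[z --> (t, x)] --> flow_at x t.
  move=> U /h [[A B] [At Bx] AB]; exists (A, existT _ G @` B) => /=.
    by split => //; exact: existT_nbhs.
  by move=> [s _] /= [As [y By <-]]; exact: (AB (s, y)).
have flow_vec_at y s : good (existT _ G y : simplices R g) ->
    vec (flow_at y s) = flow_vec (vec y) s.
  by move=> gy; rewrite /vec set_valE val_insubd (mem_set (flow_vec_simplex s gy)).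
move=> U [_ /= [[W oW <-] Wx] WU].
have near_good : \forall z \near (t, x), good (existT _ G z.2 : simplices R g).
  have gx : \forall y \near x, good (existT _ G y : simplices R g) := good_near gp.
  exact: (@cvg_snd _ _ (nbhs t) (nbhs x) _ _ gx).
have fv : flow_vec (vec z.2) z.1 @[z --> (t, x)] --> flow_vec (vec x) t.
  apply: cvg_flow_vec; last by rewrite gt_eqF // (sum_flow_len_gt0 t gp).
    exact: (cvg_comp snd (@vec (val G)) cvg_snd (@continuous_vec _ x)).
  exact: cvg_fst.
have near_W : \forall z \near (t, x), W (flow_vec (vec z.2) z.1).
  by apply: fv; rewrite -flow_vec_at //; exact: open_nbhs_nbhs.
apply: filterS2 near_good near_W => z gz Wz; apply: WU.
by move: Wz; rewrite -(flow_vec_at _ _ gz).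
Qed.

(** * Descent of the flow to the quotient *)

Lemma continuous_MG_class : continuous (@MG_class R g).
Proof. exact: pi_continuous. Qed.

Lemma near_flow (U : set (MG R g)) (p : simplices R g) t :
  open U -> good p -> U (MG_class (flow p t)) ->
  \forall s \near t & q \near p, U (MG_class (flow q s)).
Proof.
move=> oU gp Upt.
have := cvg_comp (fun z => flow z.2 z.1) (@MG_class R g) (cvg_flow (t := t) gp)
  (@continuous_MG_class _).
by apply; exact: open_nbhs_nbhs.
Qed.

Lemma open_flow_tube (U : set (MG R g)) (J : set R) : open U -> compact J ->
  open [set p : simplices R g |
         good p /\ J `<=` [set s | U (MG_class (flow p s))]].
Proof.
move=> oU cJ; rewrite openE => p [gp pJ].
have nearJ : \forall q \near p, J `<=` [set s | U (MG_class (flow q s))].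
  have cov := (compact_near_coveringP J).1 cJ.
  by apply: (cov _ (nbhs p) (fun q s => U (MG_class (flow q s)))) => s /pJ; exact: near_flow.
apply: filterS2 (good_near gp) nearJ => q gq qJ; exact: conj.
Qed.

(** [repr] picks an arbitrary representative; over MG_g^0 the choice does not matter, by
    [MG_equiv_flow]. *)
Definition spine_homotopy (mt : MG R g * R) : MG R g := MG_class (flow (repr mt.1) mt.2).

Lemma MG_class_repr (m : MG R g) : MG_class (repr m) = m.
Proof. exact: reprK. Qed.

Lemma spine_homotopy_class p t : good p -> spine_homotopy (MG_class p, t) = MG_class (flow p t).
Proof.
move=> gp; apply/MG_classP; rewrite MG_equiv_sym; apply: MG_equiv_flow => //.
by apply/MG_classP; rewrite MG_class_repr.
Qed.

Lemma continuous_spine_homotopy (m : MG R g) t : MG0 R g m -> {for (m, t), continuous spine_homotopy}.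
Proof.
rewrite -(MG_class_repr m) => /MG0P; set p := repr m => gp.
move=> A; rewrite spine_homotopy_class // nbhsE => -[U [oU Upt] UA].
(* Halving the radius puts a closed, hence compact, interval inside the ball of times whose flow of
   p stays in U. *)
have [J [cJ Jt pJ]] : exists J : set R,
    [/\ compact J, nbhs t J & J `<=` [set s | U (MG_class (flow p s))]].
  have [[C B] /= [Ct Bp] CB] := near_flow oU gp Upt.
  have /nbhs_ballP[e /= e0 eC] := Ct.
  exists `[t - e / 2, t + e / 2]; split; first exact: segment_compact.
    have e20 : 0 < e / 2 by rewrite divr_gt0.
    apply: filterS (nbhsx_ballx t _ e20) => s; rewrite /ball /= ltr_norml in_itv /=.
    by move=> /andP[? ?]; apply/andP; split; lra.
  move=> s /=; rewrite in_itv /= => /andP[s1 s2]; apply: (CB (s, p)); split=> /=.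
    by apply: eC; rewrite /ball /= ltr_norml; apply/andP; split; lra.
  exact: nbhs_singleton.
pose W := [set q | good q /\ J `<=` [set s | U (MG_class (flow q s))]].
(* W is saturated, so it is the full preimage of [piW]; as W is open by the tube lemma, [piW] is
   open in the quotient. *)
have satW q q' : MG_equiv q q' -> W q -> W q'.
  move=> qq' [gq qJ]; split; first exact/(MG_equiv_good qq').
  by move=> s /qJ /=; have /MG_classP -> := @MG_equiv_flow _ _ _ _ s gq qq'.
pose piW : set (MG R g) := [set n | W (repr n)].
have opiW : open piW.
  rewrite /open /= /quotient_open.
  rewrite (_ : _ @^-1` _ = W); first exact: open_flow_tube.
  apply/seteqP; split=> q /=; apply: satW; [|rewrite MG_equiv_sym];
  by apply/MG_classP; exact: MG_class_repr.
exists (piW, J) => [|[n s] [[gn nJ] Js]].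
  split=> //=; apply: (open_nbhs_nbhs (A := piW)); split=> //.
  apply: (satW p) => //; apply/MG_classP; by rewrite MG_class_repr.
apply: UA; rewrite -(MG_class_repr n) spine_homotopy_class //; exact: nJ.
Qed.

End FlowContinuity.

Theorem theorem4p6 (R : realType) (g : nat) (hg : (2 <= g)%N) :
  deformation_retract R (MG0 R g) (spine R g).
Proof.
split=> [m [p [w0 [F [fo cu]]] <-]|]; first exact/MG0P/(in_cube_good w0 fo cu).
exists (@spine_homotopy R g); split.
(* Continuity at each of these points within the whole product of MG_g and R restricts to the
   subspace. *)
- apply: continuous_in_subspaceT => -[m t] /set_mem[X _].
  exact: continuous_spine_homotopy.
- move=> m t Xm _; rewrite -(MG_class_repr m) in Xm *; move/MG0P: Xm => gm.
  by rewrite spine_homotopy_class //; apply/MG0P/good_flow.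
- move=> m Xm; rewrite -(MG_class_repr m) in Xm *; move/MG0P: Xm => gm.
  by rewrite spine_homotopy_class // flow0.
- move=> m Xm; rewrite -(MG_class_repr m) in Xm *; move/MG0P: Xm => gm.
  by rewrite spine_homotopy_class //; exact: spine_flow1.
- move=> _ t [p [w0 [F [fo cu]]] <-] _.
  rewrite spine_homotopy_class; last exact: in_cube_good cu.
  by rewrite (in_cube_flow _ w0 fo cu).
Qed.
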